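(* Let $\chi(H;X)$ denote the chromatic polynomial of hypergraphs. Then $\chi$ is weakly distinguishing on hypergraphs and on $r$-uniform hypergraphs for $r\ge 3$, that is: (i) $$\lim_{n\to\infty}\frac{\mathcal{U}_{\chi}(n)}{\mathcal{H}(n)}=0.$$ (ii) For every integer $r\ge 3$, $$\lim_{n\to\infty}\frac{\mathcal{U}^r_{\chi}(n)}{\mathcal{H}^r(n)}=0.$$
   Context: A (finite) hypergraph $H$ consists of a finite vertex set $V(H)$ and a set $E(H)$ of subsets of $V(H)$, called hyperedges. $H$ is $r$-uniform if every hyperedge has exactly $r$ elements. Two hypergraphs are isomorphic if there is a bijection between their vertex sets under which a set of vertices is a hyperedge of the first iff its image is a hyperedge of the second. For $k\in\mathbb{N}$, a map $f:V(H)\to[k]=\{1,\dots,k\}$ is a proper coloring of $H$ with at most $k$ colors if every $e\in E(H)$ contains two vertices $u,v\in e$ with $f(u)\ne f(v)$. $\chi(H;k)$ is the number of such colorings; it is a polynomial in $k$, and $\chi(H;X)\in\mathbb{Z}[X]$ denotes the corresponding polynomial. For a univariate hypergraph polynomial $P$ (an isomorphism-invariant map from hypergraphs to $\mathbb{Z}[X]$): a hypergraph $H$ is $P$-unique if every hypergraph $H_1$ with $P(H_1;X)=P(H;X)$ is isomorphic to $H$; an $r$-uniform hypergraph $H$ is $r$-$P$-unique if every $r$-uniform hypergraph $H_1$ with $P(H_1;X)=P(H;X)$ is isomorphic to $H$. $\mathcal{H}(n)$ (resp. $\mathcal{H}^r(n)$) is the number of non-isomorphic hypergraphs (resp. $r$-uniform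 hypergraphs) on $n$ vertices. $\mathcal{U}_P(n)$ is the number of non-isomorphic $P$-unique hypergraphs on $n$ vertices, and $\mathcal{U}^r_P(n)$ is the number of non-isomorphic $r$-$P$-unique $r$-uniform hypergraphs on $n$ vertices. *)

(* Defs.v *)
From HB Require Import structures.
From mathcomp Require Import all_boot all_order all_algebra.
From mathcomp Require Import boolp.

Set Implicit Arguments.
Unset Strict Implicit.
Unset Printing Implicit Defensive.

Import GRing.Theory Num.Theory.

(* The empty set and singletons are allowed as hyperedges; a hypergraph that
   has one of them has no proper coloring, so its chromatic polynomial is 0. *)
Record hypergraph := Hypergraph {
  vertex : finType;
  hyperedges : {set {set vertex}}
}.

Definition isomorphic (H K : hypergraph) : Prop :=
  exists2 phi : vertex H -> vertex K, bijective phi &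
    forall A : {set vertex H}, (A \in hyperedges H) = (phi @: A \in hyperedges K).

Lemma isomorphic_refl H : isomorphic H H.
Proof. by exists id => [|A]; [exists id | rewrite imset_id]. Qed.

Lemma isomorphic_sym H K : isomorphic H K -> isomorphic K H.
Proof.
case=> phi [psi phiK psiK] phiE; exists psi; first by exists phi.
move=> A; rewrite phiE -imset_comp (eq_imset (g := id)) ?imset_id //.
Qed.

Lemma isomorphic_trans H K L :
  isomorphic H K -> isomorphic K L -> isomorphic H L.
Proof.
case=> phi phi_bij phiE [psi psi_bij psiE].
exists (psi \o phi); first exact: bij_comp.
by move=> A; rewrite phiE psiE imset_comp.
Qed.

Definition uniform (r : nat) (H : hypergraph) : Prop :=
  forall e : {set vertex H}, e \in hyperedges H -> #|e| = r.

Definition proper_coloring (H : hypergraph) (k : nat)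
    (f : {ffun vertex H -> 'I_k}) : bool :=
  [forall e in hyperedges H, exists u in e, exists v in e, f u != f v].

Definition num_colorings (H : hypergraph) (k : nat) : nat :=
  #|[set f : {ffun vertex H -> 'I_k} | proper_coloring f]|.

Section ColoringPolynomial.

Lemma card_kernel (T : finType) (k : nat) (P : {set {set T}}) :
    partition P [set: T] ->
  #|[set f : {ffun T -> 'I_k} | preim_partition f [set: T] == P]| = k ^_ #|P|.
Proof.
move=> partP; have [/eqP covP tiP P0] := and3P partP.
have PbP x : pblock P x \in P by rewrite pblock_mem ?covP ?inE.
pose S : finType := {B : {set T} | B \in P}.
pose cl x : S := exist _ (pblock P x) (PbP x).
pose lft (g : {ffun S -> 'I_k}) : {ffun T -> 'I_k} := [ffun x => g (cl x)].
have clE x y : (cl x == cl y) = (pblock P x == pblock P y) by [].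
have clB (B : S) : exists x, cl x = B.
  case: B => B PB; have /set0Pn[x xB] : B != set0 by apply: contraNneq P0 => <-.
  by exists x; apply/val_inj => /=; rewrite (def_pblock tiP PB).
have lft_inj : injective lft.
  move=> g h /ffunP eq_gh; apply/ffunP => B; have [x <-] := clB B.
  by have := eq_gh x; rewrite !ffunE.
have <- : #|S| = #|P| by rewrite card_sig.
have <- : #|'I_k| ^_ #|S| = k ^_ #|S| by rewrite card_ord.
rewrite -card_inj_ffuns -(card_imset _ lft_inj).
apply: eq_card => f; rewrite inE; apply/eqP/imsetP => [kerP | [g]].
- have fE x y : (f x == f y) = (cl x == cl y).
    rewrite clE eq_pblock ?covP ?inE // -kerP.
    rewrite pblock_equivalence_partition ?inE //.
    by split=> // /eqP ->.
  have rep (B : S) : {x | cl x = B} by apply: cid.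
  have repK x : f (projT1 (rep (cl x))) = f x.
    by apply/eqP; rewrite fE; case: (rep _) => y /= ->.
  exists [ffun B => f (projT1 (rep B))].
    rewrite inE; apply/injectiveP => B C; rewrite !ffunE => /eqP.
    by rewrite fE; case: (rep B) (rep C) => x /= <- [y /= <-] /eqP.
  by apply/ffunP => x; rewrite !ffunE repK.
- rewrite inE => /injectiveP g_inj ->.
  rewrite -[RHS](preim_partition_pblock partP).
  apply: eq_imset => x; apply/setP => y; rewrite !inE !ffunE.
  by rewrite (inj_eq g_inj) clE.
Qed.

Lemma proper_kernel (H : hypergraph) (k : nat) (f : {ffun vertex H -> 'I_k}) :
  proper_coloring f =
    [forall e in hyperedges H, exists u in e, exists v in e,
      v \notin pblock (preim_partition f [set: vertex H]) u].
Proof.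
apply: eq_forallb => e; congr (_ ==> _); apply: eq_existsb => u.
congr (_ && _); apply: eq_existsb => v; congr (_ && ~~ _).
by rewrite pblock_equivalence_partition ?inE //; split=> // /eqP ->.
Qed.

Local Open Scope ring_scope.

Definition ffact_poly (m : nat) : {poly int} := \prod_(i < m) ('X - i%:R%:P).

Lemma ffact_polyE (m k : nat) : (ffact_poly m).[k%:R] = (k ^_ m)%:R.
Proof.
rewrite /ffact_poly horner_prod ffact_prod natr_prod.
have [le_mk | lt_km] := leqP m k.
  apply: eq_bigr => i _; rewrite hornerXsubC natrB //.
  exact: leq_trans (ltnW (ltn_ord i)) le_mk.
rewrite (bigD1 (Ordinal lt_km)) //= hornerXsubC subrr mul0r.
by rewrite (bigD1 (Ordinal lt_km)) //= subnn mul0r.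
Qed.

Lemma coloring_polynomial (H : hypergraph) :
  exists p : {poly int}, forall k : nat, p.[k%:R] = (num_colorings H k)%:R.
Proof.
pose ok (P : {set {set vertex H}}) :=
  partition P [set: vertex H] &&
  [forall e in hyperedges H, exists u in e, exists v in e, v \notin pblock P u].
exists (\sum_(P | ok P) ffact_poly #|P|) => k.
rewrite horner_sum /num_colorings -sum1_card natr_sum.
pose ker (f : {ffun vertex H -> 'I_k}) := preim_partition f [set: vertex H].
rewrite (partition_big ker ok) /=; last first.
  move=> f; rewrite inE proper_kernel => okf.
  by rewrite /ok preim_partitionP.
apply: eq_bigr => P /andP[partP okP].
rewrite ffact_polyE -card_kernel // -natr_sum sum1_card; congr _%:R.
apply: eq_card => f; rewrite !inE.
rewrite -[RHS]/((f \in [set g | proper_coloring g]) && (ker f == P)) inE.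
by rewrite proper_kernel; case: eqP => [->|]; rewrite ?andbF ?okP.
Qed.

Lemma poly_nat_inj (p q : {poly int}) :
  (forall k : nat, p.[k%:R] = q.[k%:R]) -> p = q.
Proof.
move=> eq_pq; apply/eqP; rewrite -subr_eq0; apply: contraT => nz.
pose s := [seq i%:R : int | i <- iota 0 (size (p - q))].
have := max_poly_roots nz (rs := s).
rewrite size_map size_iota ltnn => /(_ _ _)-> //.
  by apply/allP => _ /mapP[i _ ->]; rewrite /root hornerD hornerN eq_pq subrr.
by rewrite map_inj_uniq ?iota_uniq // => i j /eqP; rewrite eqr_nat => /eqP.
Qed.

End ColoringPolynomial.

(* By chiE and poly_nat_inj, chi H does not depend on the choice made by cid. *)
Definition chi (H : hypergraph) : {poly int} :=
  projT1 (cid (coloring_polynomial H)).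

Lemma chiE (H : hypergraph) (k : nat) :
  ((chi H).[k%:R] = (num_colorings H k)%:R)%R.
Proof. exact: (projT2 (cid (coloring_polynomial H)) k). Qed.

Lemma leq_num_colorings (H K : hypergraph) (k : nat) :
  isomorphic H K -> num_colorings K k <= num_colorings H k.
Proof.
case=> phi [psi phiK psiK] phiE.
pose pull (f : {ffun vertex K -> 'I_k}) := [ffun x => f (phi x)].
have pull_inj : injective pull.
  move=> f g /ffunP eq_fg; apply/ffunP => y.
  by have := eq_fg (psi y); rewrite !ffunE psiK.
rewrite /num_colorings -(card_imset _ pull_inj); apply: subset_leq_card.
apply/subsetP => g /imsetP[f + ->{g}]; rewrite !inE => /forall_inP f_ok.
apply/forall_inP => e; rewrite phiE => /f_ok.
case/exists_inP => y /imsetP[u ue ->{y}] /exists_inP[y /imsetP[v ve ->{y}] fuv].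
by apply/exists_inP; exists u => //; apply/exists_inP; exists v; rewrite ?ffunE.
Qed.

Lemma chi_iso (H K : hypergraph) : isomorphic H K -> chi H = chi K.
Proof.
move=> isoHK; apply: poly_nat_inj => k; rewrite !chiE; congr (_%:R)%R.
apply/eqP; rewrite eqn_leq !leq_num_colorings //.
exact: isomorphic_sym.
Qed.

Record hypergraph_polynomial := HypergraphPolynomial {
  hpoly :> hypergraph -> {poly int};
  hpoly_iso : forall H K, isomorphic H K -> hpoly H = hpoly K
}.

Definition chromatic_polynomial : hypergraph_polynomial :=
  HypergraphPolynomial chi_iso.

Definition P_unique (P : hypergraph_polynomial) (H : hypergraph) : Prop :=
  forall H1 : hypergraph, P H1 = P H -> isomorphic H1 H.

Definition r_P_unique (r : nat) (P : hypergraph_polynomial)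
    (H : hypergraph) : Prop :=
  uniform r H /\
  forall H1 : hypergraph, uniform r H1 -> P H1 = P H -> isomorphic H1 H.

(* Every hypergraph on n vertices is isomorphic to one with vertex set 'I_n,
   so it suffices to count classes of labelled hypergraphs there. *)
Definition num_iso_classes (n : nat) (Q : hypergraph -> Prop) : nat :=
  #|equivalence_partition
      (fun E F : {set {set 'I_n}} => `[< isomorphic (Hypergraph E) (Hypergraph F) >])
      [set E : {set {set 'I_n}} | `[< Q (Hypergraph E) >] ]|.

Definition num_hypergraphs (n : nat) : nat :=
  num_iso_classes n (fun=> True).

Definition num_uniform_hypergraphs (r n : nat) : nat :=
  num_iso_classes n (uniform r).

Definition num_unique (P : hypergraph_polynomial) (n : nat) : nat :=
  num_iso_classes n (P_unique P).

Definition num_uniform_unique (r : nat) (P : hypergraph_polynomial)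
    (n : nat) : nat :=
  num_iso_classes n (r_P_unique r P).

(* Main.v *)
Require Import Defs.
From mathcomp Require Import all_classical all_reals all_analysis.
From mathcomp Require Import all_boot all_order all_algebra.
From mathcomp Require Import perm zify.
Import numFieldNormedType.Exports.

Set Implicit Arguments.
Unset Strict Implicit.
Unset Printing Implicit Defensive.

(** Both limits hold because [n.+1] times the number of unique classes is at
    most the number of all classes, for every [n] in the first part and for
    all large [n] in the second; [ratio_cvg0] turns this into the limit.

    All hypergraphs.  A hypergraph with a hyperedge of at most one vertex has
    no proper coloring, so its chromatic polynomial is 0; as 0 is the
    polynomial of hypergraphs on any number of vertices, a unique hypergraph
    has no such hyperedge.  Adding to it [j] singletons, for [j = 0, ..., n],
    gives [n.+1] hypergraphs from which the original one is recovered by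
    deleting the singletons, and [j] by counting them
    ([unique_classes_leq]).

    Uniform hypergraphs.  There are too few polynomials.  In the basis of the
    falling factorials, the [m]-th coefficient of the chromatic polynomial of
    a hypergraph on [n] vertices counts the partitions of the vertices into
    [m] blocks none of which contains a hyperedge; such a partition provides a
    coloring with [m] colors, so there are at most [n ^ n] of them.  Hence
    there are at most [(n ^ n).+1 ^ n.+1] polynomials, which is [2] to the
    power O(n^2 log n), and no two unique classes share one
    ([uniform_unique_classes_leq]).  On the other hand a class has at most
    [n!] labelled members, so that there are at least [2 ^ 'C(n, r) / n!]
    classes ([leq_uniform_classes]), and [r >= 3] makes ['C(n, r)] at least of
    order n^3. *)

(** * Counting isomorphism classes *)

(** A system of representatives lets classes be counted through labelled
    hypergraphs, without handling the blocks of the partition. *)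
Lemma iso_representatives (n : nat) (Q : hypergraph -> Prop) :
  exists X : {set {set {set 'I_n}}},
    [/\ #|X| = num_iso_classes n Q,
        forall E, E \in X -> Q (Hypergraph E),
        {in X &, forall E F, isomorphic (Hypergraph E) (Hypergraph F) -> E = F}
      & forall F : {set {set 'I_n}}, Q (Hypergraph F) ->
          exists2 E, E \in X & isomorphic (Hypergraph E) (Hypergraph F)].
Proof.
rewrite /num_iso_classes.
set iso := fun E F : {set {set 'I_n}} => _.
set D : {set {set {set 'I_n}}} := finset _.
have isoE : {in D & &, equivalence_rel iso}.
  move=> E F G _ _ _; split; first exact/asboolP/isomorphic_refl.
  move=> /asboolP EF; apply/asboolP/asboolP; apply: isomorphic_trans => //.
  exact: isomorphic_sym.
have partD := equivalence_partitionP isoE.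
have trX := transversalP partD.
have XD := subsetP (transversal_sub trX).
exists (transversal (equivalence_partition iso D) D); split.
- exact: card_transversal trX.
- by move=> E /XD; rewrite inE => /asboolP.
- move=> E F EX FX EF; apply: (pblock_inj trX) => //; apply/eqP.
  rewrite eq_pblock; last 2 first.
  + by case/and3P: partD.
  + by rewrite (cover_partition partD) XD.
  by rewrite pblock_equivalence_partition ?XD //; apply/asboolP.
- move=> F QF; have FD : F \in D by rewrite inE; apply/asboolP.
  have PF : pblock (equivalence_partition iso D) F
      \in equivalence_partition iso D.
    by rewrite pblock_mem ?(cover_partition partD).
  have EX := repr_mem_transversal trX F PF.
  exists (transversal_repr F (transversal (equivalence_partition iso D) D)
    (pblock (equivalence_partition iso D) F)) => //.
  apply: isomorphic_sym; apply/asboolP; rewrite -/(iso F _).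
  rewrite -(pblock_equivalence_partition isoE) //; last exact: XD.
  exact: repr_mem_pblock trX F _ PF.
Qed.

Lemma leq_num_iso_classes (n : nat) (Q : hypergraph -> Prop) (A : finType)
    (B : {set A}) (G : A -> {set {set 'I_n}}) :
    (forall a, a \in B -> Q (Hypergraph (G a))) ->
    {in B &, forall a b,
      isomorphic (Hypergraph (G a)) (Hypergraph (G b)) -> a = b} ->
  #|B| <= num_iso_classes n Q.
Proof.
move=> QG G_inj; have [X [<- _ _ X_all]] := iso_representatives n Q.
have rep a : exists E, a \in B ->
    E \in X /\ isomorphic (Hypergraph E) (Hypergraph (G a)).
  case aB: (a \in B); last by exists set0.
  by have [E EX isoE] := X_all _ (QG a aB); exists E.
have [rho rhoP] := choice rep.
rewrite -(@card_in_imset _ _ rho) => [|a b aB bB eq_ab].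
  by apply/subset_leq_card/subsetP => _ /imsetP[a /rhoP[aX _] ->].
apply: G_inj => //; have [[_ isoa] [_ isob]] := (rhoP a aB, rhoP b bB).
by apply: isomorphic_trans isob; rewrite -eq_ab; apply: isomorphic_sym.
Qed.

Lemma num_iso_classes_leq (n : nat) (Q : hypergraph -> Prop) (S : finType)
    (inv : {set {set 'I_n}} -> S) :
    (forall E F, Q (Hypergraph E) -> Q (Hypergraph F) -> inv E = inv F ->
      isomorphic (Hypergraph E) (Hypergraph F)) ->
  num_iso_classes n Q <= #|S|.
Proof.
move=> inv_iso; have [X [<- XQ X_inj _]] := iso_representatives n Q.
rewrite -(@card_in_imset _ _ inv) ?max_card // => E F EX FX eq_inv.
by apply: X_inj => //; apply: inv_iso => //; apply: XQ.
Qed.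

(** Each member of [D] arises from the representative of its class by one of
    the [n!] permutations of the vertices. *)
Lemma leq_labelled_iso_classes (n : nat) (Q : hypergraph -> Prop)
    (D : {set {set {set 'I_n}}}) :
    (forall E, E \in D -> Q (Hypergraph E)) ->
  #|D| <= num_iso_classes n Q * n`!.
Proof.
move=> DQ; have [X [<- _ _ X_all]] := iso_representatives n Q.
rewrite -card_Sn -cardsT -cardsX.
pose relabel (Es : {set {set 'I_n}} * {perm 'I_n}) :=
  [set [set Es.2 x | x in e] | e : {set 'I_n} in Es.1].
apply: leq_trans (leq_imset_card relabel _).
apply/subset_leq_card/subsetP => F /DQ/X_all[E EX [phi phi_bij phiE]].
apply/imsetP; exists (E, perm (bij_inj phi_bij)); first by rewrite inE EX inE.
have imE (e : {set 'I_n}) : [set perm (bij_inj phi_bij) x | x in e] = phi @: e.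
  by apply: eq_imset => x; rewrite permE.
apply/setP => e; apply/idP/imsetP => /= [eF | [d dE ->]]; last first.
  by rewrite imE -phiE.
have [psi phiK psiK] := phi_bij.
have eK : phi @: (psi @: e) = e.
  by rewrite -imset_comp (eq_imset (g := id)) ?imset_id //.
by exists (psi @: e); rewrite ?imE ?eK // [_ \in E]phiE eK.
Qed.

(** * Adding singletons to a unique hypergraph *)

Lemma chi_eq0 (H : hypergraph) (e : {set vertex H}) :
  e \in hyperedges H -> #|e| <= 1 -> chi H = 0%R.
Proof.
move=> eH e1; apply: poly_nat_inj => k; rewrite chiE horner0.
suff -> : num_colorings H k = 0 by [].
apply/eqP; rewrite cards_eq0 -subset0; apply/subsetP => f.
rewrite !inE => /forall_inP/(_ e eH)/exists_inP[u ue /exists_inP[v ve]].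
by rewrite (card_le1_eqP e1 u v ue ve) eqxx.
Qed.

(** Otherwise the polynomial is 0, which is also that of a hypergraph with one
    more vertex and the empty hyperedge. *)
Lemma chi_unique_card_gt1 (n : nat) (E : {set {set 'I_n}}) (e : {set 'I_n}) :
  P_unique chromatic_polynomial (Hypergraph E) -> e \in E -> 1 < #|e|.
Proof.
move=> uE eE; rewrite ltnNge; apply/negP => e1.
pose K := @Hypergraph (option 'I_n) [set set0].
have /uE[phi /bij_eq_card] :
    chromatic_polynomial K = chromatic_polynomial (Hypergraph E).
  rewrite /= (@chi_eq0 K set0) ?(@chi_eq0 (Hypergraph E) e) ?cards0 //.
  by rewrite inE.
by rewrite card_option !card_ord => /eqP; rewrite eqn_leq ltnn.
Qed.

Definition initial_singletons (n j : nat) : {set {set 'I_n}} :=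
  [set [set i] | i : 'I_n & i < j].

Lemma card_initial_singletons (n j : nat) :
  j <= n -> #|initial_singletons n j| = j.
Proof.
move=> le_jn; rewrite card_imset; last exact: set1_inj.
have widen_inj : injective (widen_ord le_jn) by move=> i k [] /val_inj.
rewrite -[RHS]card_ord -cardsT -(card_imset _ widen_inj).
apply: eq_card => i; rewrite !inE; apply/idP/imsetP => [lt_ij | [k _ ->]] /=.
  by exists (Ordinal lt_ij) => //; apply: val_inj.
exact: ltn_ord.
Qed.

(** A unique hypergraph has no hyperedge of size 1, so both it and [j] can be
    read off, up to isomorphism, from its extension by [j] singletons: this
    makes [n.+1] classes out of each unique one. *)
Lemma unique_classes_leq (n : nat) :
  n.+1 * num_unique chromatic_polynomial n <= num_hypergraphs n.
Proof.
rewrite /num_unique; have [X [<- XQ X_inj _]] :=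
  iso_representatives n (P_unique chromatic_polynomial).
have X_gt1 E e (EX : E \in X) : e \in E -> 1 < #|e|.
  exact: (chi_unique_card_gt1 (XQ E EX)).
pose ext (Ej : {set {set 'I_n}} * 'I_n.+1) :=
  Ej.1 :|: initial_singletons n Ej.2.
have ext1 E j (e : {set 'I_n}) : E \in X -> #|e| = 1 ->
    (e \in ext (E, j)) = (e \in initial_singletons n j).
  move=> EX e1; rewrite inE /=; case: (boolP (e \in E)) => //= eE.
  by have := X_gt1 _ _ EX eE; rewrite e1.
have ext2 E j (e : {set 'I_n}) : #|e| != 1 -> (e \in ext (E, j)) = (e \in E).
  move=> e1; rewrite inE orbC; case: imsetP => //= -[i _ e_i].
  by rewrite e_i cards1 in e1.
rewrite -[n.+1]card_ord -cardsT mulnC -cardsX.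
apply: (@leq_num_iso_classes _ _ _ _ ext) => // -[E j] [F k].
rewrite !inE !andbT => /= EX FX [phi phi_bij phiE].
have phi_inj := bij_inj phi_bij.
have phi_card (e : {set 'I_n}) : #|phi @: e| = #|e| by rewrite card_imset.
have EF : E = F.
  apply: X_inj => //; exists phi => // e /=.
  have [e1 | e1] := eqVneq #|e| 1; last first.
    by have := phiE e; rewrite /= !ext2 ?phi_card.
  apply/idP/idP => [/(X_gt1 _ _ EX) | /(X_gt1 _ _ FX)];
    by rewrite ?phi_card e1.
congr (_, _) => //; apply: val_inj => /=.
rewrite -[LHS](@card_initial_singletons n) -1?ltnS //.
rewrite -[RHS](@card_initial_singletons n) -1?ltnS //.
rewrite -(card_imset _ (imset_inj phi_inj)).
have [psi phiK psiK] := phi_bij.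
have card1 m (e : {set 'I_n}) : e \in initial_singletons n m -> #|e| = 1.
  by case/imsetP => i _ ->; rewrite cards1.
apply: eq_card => e; apply/imsetP/idP => [[d dj ->] | ek].
  by have := phiE d; rewrite /= !ext1 ?phi_card ?(card1 _ _ dj) // dj => <-.
have eK : phi @: (psi @: e) = e.
  by rewrite -imset_comp (eq_imset (g := id)) ?imset_id //.
have psi_e1 : #|psi @: e| = 1 by rewrite -phi_card eK (card1 _ _ ek).
exists (psi @: e) => //; have := phiE (psi @: e).
by rewrite /= eK !ext1 ?psi_e1 ?(card1 _ _ ek) // ek.
Qed.

(** * Counting chromatic polynomials *)

Definition proper_partitions (H : hypergraph) (m : nat) :
    {set {set {set vertex H}}} :=
  [set P | [&& partition P [set: vertex H], #|P| == m &
    [forall e in hyperedges H, exists u in e, exists v in e,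
      v \notin pblock P u]]].

(** Group the proper colorings by their partition into color classes; a
    partition into [m] blocks comes from [k ^_ m] colorings. *)
Lemma num_colorings_partitions (H : hypergraph) (k : nat) :
  num_colorings H k =
    \sum_(m < #|vertex H|.+1) #|proper_partitions H m| * k ^_ m.
Proof.
pose ker (f : {ffun vertex H -> 'I_k}) := preim_partition f [set: vertex H].
have ker_part f : partition (ker f) [set: vertex H].
  exact: preim_partitionP.
have ker_small f : #|ker f| < #|vertex H|.+1.
  by rewrite ltnS -(card_transversal (transversalP (ker_part f))) max_card.
rewrite /num_colorings -sum1_card.
rewrite (partition_big (fun f => inord #|ker f| : 'I_#|vertex H|.+1) xpredT) //=.
apply: eq_bigr => m _; rewrite -sum_nat_const.
rewrite (partition_big ker (mem (proper_partitions H m))) /=; last first.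
  move=> f /andP[]; rewrite inE proper_kernel => f_ok /eqP <-.
  by rewrite inE ker_part inordK //= eqxx.
apply: eq_bigr => P; rewrite inE => /and3P[partP /eqP card_P P_ok].
rewrite sum1_card -card_P -(card_kernel k partP); apply: eq_card => f.
rewrite !inE -[LHS]/(((f \in [set g | proper_coloring g])
  && (inord #|ker f| == m)) && (ker f == P)) -/(ker f) inE proper_kernel.
rewrite -/(ker f); case: (ker f =P P) => [->|_]; rewrite ?andbF // P_ok.
by rewrite -val_eqE /= inordK ?card_P ?ltn_ord // eqxx.
Qed.

(** Each of these partitions yields a proper coloring with [m] colors. *)
Lemma card_proper_partitions (H : hypergraph) (m : nat) :
  m <= #|vertex H| -> #|proper_partitions H m| <= #|vertex H| ^ #|vertex H|.
Proof.
move=> le_m; apply: (@leq_trans (num_colorings H m)).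
  rewrite num_colorings_partitions (bigD1 (Ordinal (le_m : m < _.+1))) //= ffactnn.
  by rewrite (leq_trans _ (leq_addr _ _)) // leq_pmulr // fact_gt0.
rewrite (leq_trans (max_card _)) // card_ffun card_ord.
by case: (#|vertex H|) le_m => [|n] le_m; rewrite ?expn0 ?leq_exp2r.
Qed.

(** The numbers of proper partitions into [m <= n] blocks determine the
    chromatic polynomial, hence the class of a unique hypergraph. *)
Lemma uniform_unique_classes_leq (r n : nat) :
  num_uniform_unique r chromatic_polynomial n <= (n ^ n).+1 ^ n.+1.
Proof.
pose profile (E : {set {set 'I_n}}) : {ffun 'I_n.+1 -> 'I_(n ^ n).+1} :=
  [ffun m : 'I_n.+1 => inord #|proper_partitions (Hypergraph E) m|].
rewrite -[X in X ^ n.+1]card_ord -[X in _ ^ X]card_ord -card_ffun.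
apply: (@num_iso_classes_leq _ _ _ profile) => E F [rE _] [_ uF] /ffunP eqEF.
apply: uF => //=; apply: poly_nat_inj => k; rewrite !chiE; congr _%:R%R.
rewrite !num_colorings_partitions /= card_ord; apply: eq_bigr => m _.
congr (_ * _); have /(congr1 val) := eqEF m; rewrite !ffunE /= !inordK //.
  have := @card_proper_partitions (Hypergraph F) m.
  by rewrite /= card_ord ltnS; apply; rewrite -ltnS.
have := @card_proper_partitions (Hypergraph E) m.
by rewrite /= card_ord ltnS; apply; rewrite -ltnS.
Qed.

Lemma leq_uniform_classes (r n : nat) :
  2 ^ 'C(n, r) <= num_uniform_hypergraphs r n * n`!.
Proof.
rewrite -[n in 'C(n, r)]card_ord -card_draws -card_powerset.
apply: leq_labelled_iso_classes => E; rewrite inE => /subsetP EU e /EU.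
by rewrite inE => /eqP.
Qed.

(** * Comparing the growth rates *)

(** With [q = n %/ (2 * c)], [n <= 2 * c * q.+1 <= 2 ^ (2 * c + q)], and
    [c * (2 * c + q) <= n]: each of the two terms takes at most half of [n]. *)
Lemma expn_leq_exp2 (c n : nat) : 0 < c -> 4 * c ^ 2 <= n -> n ^ c <= 2 ^ n.
Proof.
move=> c0 cn; set q := n %/ (2 * c).
have n_eq : n <= (2 * c) * q.+1.
  by rewrite ltnW // mulnC ltn_ceil // muln_gt0.
have qn : q * (2 * c) <= n by apply: leq_trunc_div.
apply: (@leq_trans ((2 ^ (2 * c) * 2 ^ q) ^ c)).
  rewrite leq_exp2r //; apply: leq_trans n_eq _.
  by apply: leq_mul; [apply: ltnW|]; apply: (@ltn_expl 2).
by rewrite -expnD -expnM leq_exp2l //; nia.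
Qed.

Lemma leq_fact_exp (n : nat) : n`! <= n ^ n.
Proof.
elim: n => // n IHn; rewrite factS expnS leq_mul2l /= (leq_trans IHn) //.
by case: n {IHn} => // n; rewrite leq_exp2r.
Qed.

(** Pascal's rule bounds ['C(n, r)] from below by ['C(n - r + 3, 3)], which
    exceeds [(n - r) ^ 3 / 6], where [n - r >= n / 2]. *)
Lemma leq_cube_bin (r n : nat) : 3 <= r -> 2 * r <= n -> n ^ 3 <= 48 * 'C(n, r).
Proof.
move=> r3 rn; have shift k m j : 'C(m, j) <= 'C(m + k, j + k).
  by elim: k => [|k IHk]; rewrite ?addn0 // !addnS binS (leq_trans IHk) ?leq_addl.
have := shift (r - 3) (n - r + 3) 3; rewrite subnKC //.
have -> : n - r + 3 + (r - 3) = n by lia.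
have : 'C(n - r + 3, 3) * 6 = (n - r + 3) * (n - r + 2) * (n - r + 1).
  by rewrite -[6]/(3`!) bin_ffact !addnS addn0 !ffactSS ffactn0 muln1 mulnA.
have : n <= 2 * (n - r) by lia.
set m := n - r => n_le bin6 bin_le.
have : n ^ 3 <= (2 * m) ^ 3 by rewrite leq_exp2r.
by rewrite expnMn => cube_le; nia.
Qed.

Lemma eventually_unique_leq (r : nat) : 3 <= r -> exists N, forall n, N <= n ->
  n.+1 * num_uniform_unique r chromatic_polynomial n <= num_uniform_hypergraphs r n.
Proof.
move=> r3; pose c := 3 * 48; exists (4 * c ^ 2 + 2 * r) => n nN.
rewrite -(@leq_pmul2r n`!) ?fact_gt0 // (leq_trans _ (leq_uniform_classes r n)) //.
have n2 : 2 < n by lia.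
apply: (@leq_trans (n ^ (3 * n ^ 2))).
  (* The exponent is n^2 + 3 * n + 3, at most 3 * n^2 once n > 2. *)
  apply: (@leq_trans (n ^ 2 * (n ^ n.+1) ^ n.+1 * n ^ n)).
    rewrite leq_mul ?leq_fact_exp //.
    rewrite leq_mul //; first by nia.
    rewrite (leq_trans (uniform_unique_classes_leq r n)) // leq_exp2r // expnS.
    have := expn_gt0 n n; nia.
  rewrite -expnM -!expnD leq_exp2l; nia.
(* The power 48 clears the denominator of 'C(n, r) >= n^3 / 48. *)
rewrite -(@leq_exp2r _ _ 48) // -!expnM (mulnC 'C(n, r)).
apply: (@leq_trans (2 ^ n ^ 3)); last first.
  by rewrite leq_exp2l //; apply: leq_cube_bin => //; lia.
have -> : 3 * n ^ 2 * 48 = c * n ^ 2 by rewrite /c; lia.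
have -> : n ^ 3 = n * n ^ 2 by rewrite expnS.
rewrite 2!expnM leq_exp2r ?expn_gt0; last by lia.
by apply: expn_leq_exp2; lia.
Qed.

(** * The limits *)

Local Open Scope classical_set_scope.
Local Open Scope ring_scope.
Import Order.TTheory GRing.Theory Num.Theory.

Lemma ratio_cvg0 (R : realType) (u h : nat -> nat) :
    (\forall n \near \oo, (n.+1 * u n <= h n)%N) ->
  ((u n)%:R / (h n)%:R : R) @[n --> \oo] --> (0 : R).
Proof.
move=> uh; apply: (@squeeze_cvgr _ _ _ _ (cst 0) harmonic); last first.
- exact: cvg_harmonic.
- exact: cvg_cst.
near=> n; have uh_n : (n.+1 * u n <= h n)%N by near: n.
rewrite /= divr_ge0 //=; have [h0 | h0] := posnP (h n).
  by rewrite h0 invr0 mulr0 invr_ge0.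
rewrite ler_pdivrMr ?ltr0n // mulrC ler_pdivlMr ?ltr0n //.
by rewrite -natrM ler_nat mulnC.
Unshelve. all: by end_near.
Qed.

Theorem theorem3 (R : realType) :
  ((num_unique chromatic_polynomial n)%:R / (num_hypergraphs n)%:R : R)
    @[n --> \oo] --> (0 : R)
  /\
  (forall r : nat, (3 <= r)%N ->
    ((num_uniform_unique r chromatic_polynomial n)%:R
      / (num_uniform_hypergraphs r n)%:R : R) @[n --> \oo] --> (0 : R)).
Proof.
split=> [|r r3]; apply: ratio_cvg0.
  by near=> n; exact: unique_classes_leq.
have [N leN] := eventually_unique_leq r3.
by near=> n; apply: leN; near: n; exact: nbhs_infty_ge.
Unshelve. all: by end_near.
Qed.
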